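(* Let $n \geq 1$ be an integer, let $\lambda_0 \geq 0 > \lambda_1 \geq \cdots \geq \lambda_n$ be real numbers and let $z_1, z_2, z_3$ be complex numbers with $z_j = a_j + b_j i$, $a_j \in \mathbb{R}$, $b_j > 0$ for $j = 1, 2, 3$. If $\lambda_0 + \sum_{j=1}^n \lambda_j - 2\sum_{j=1}^3 |z_j| \geq 0$, then there is an $(n+7) \times (n+7)$ normal centrosymmetric nonnegative matrix with eigenvalues $\lambda_0, \lambda_1, \ldots, \lambda_n, z_1, z_2, z_3, \overline{z}_1, \overline{z}_2, \overline{z}_3$.
   Context: $J$ denotes the reverse identity matrix of the appropriate size (ones on the anti-diagonal, zeros elsewhere). A square matrix $Q$ is centrosymmetric if $JQJ = Q$, nonnegative if all entries are nonnegative, and normal if $QQ^* = Q^*Q$. *)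

(* Defs.v *)
From HB Require Import structures.
From mathcomp Require Import all_boot all_order all_algebra.
From mathcomp Require Import reals.
From mathcomp Require Import complex.
Set Implicit Arguments. Unset Strict Implicit. Unset Printing Implicit Defensive.
Import Order.TTheory GRing.Theory Num.Theory.
Local Open Scope ring_scope.

Definition revid_mx (F : pzRingType) (m : nat) : 'M[F]_m :=
  \matrix_(i < m, j < m) ((j == rev_ord i)%:R : F).

Definition centrosymmetric (F : pzRingType) (m : nat) (Q : 'M[F]_m) : Prop :=
  revid_mx F m *m Q *m revid_mx F m = Q.

Definition nonneg_mx (R : numDomainType) (m : nat) (Q : 'M[R]_m) : Prop :=
  forall i j, 0 <= Q i j.

Definition ctrmx (R : rcfType) (m : nat) (A : 'M[R[i]]_m) : 'M[R[i]]_m :=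
  (map_mx (@conjc R) A)^T.

Definition normal_mx (R : rcfType) (m : nat) (A : 'M[R[i]]_m) : Prop :=
  A *m ctrmx A = ctrmx A *m A.

Definition cplx_mx (R : rcfType) (m : nat) (Q : 'M[R]_m) : 'M[R[i]]_m :=
  map_mx (fun x : R => (x%:C)%C) Q.

Definition has_eigenvalues (R : rcfType) (m : nat) (Q : 'M[R]_m) (s : seq R[i]) : Prop :=
  char_poly (cplx_mx Q) = \prod_(mu <- s) ('X - mu%:P).

(* Main.v *)
(** A centrosymmetric matrix of order [m + (k + m)] is orthogonally similar to the direct sum of
    its action [Y] on the skew vectors (order [m]) and its action [E] on the symmetric vectors
    (order [k + m]); conversely any normal pair [Y], [E] folds back to a normal centrosymmetric
    matrix, which is nonnegative as soon as [|Y|] is dominated by the lower right block of [E]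
    and the other blocks of [E] are nonnegative.

    Folding the rotations of [z2] and [z3] gives a 4x4 normal [Y] with entries at most
    [(|z2| + |z3|) / 2] in modulus.  Folding [lam1] with [rho], and then the rotation of [z1]
    with the result, gives a 4x4 normal [X] with spectrum [rho, lam1, z1, conj z1] whose entries
    are all at least [(|z2| + |z3|) / 2] when [rho + lam1 >= 2 (|z1| + |z2| + |z3|)].  Folding
    [Y] with [X] settles [n = 1], and bordering [X] by its Perron vector first (a Fiedler gluing
    with the 1x1 zero matrix) settles [n = 2].

    To pass from [n] to [n + 2], glue the matrix obtained for the Perron root
    [lam0 + lam_(n+1) + lam_(n+2)] to the scalar [- lam_(n+2)] on the symmetric side and put
    [lam_(n+2)] on the skew side. *)

Require Import Defs.
From HB Require Import structures.
From mathcomp Require Import all_boot all_order all_algebra.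
From mathcomp Require Import reals.
From mathcomp Require Import complex.
From mathcomp Require Import ring lra zify.
Import Order.TTheory GRing.Theory Num.Theory.
Local Open Scope ring_scope.
Set Implicit Arguments.
Unset Strict Implicit.

(** * Algebra of the reversal matrix *)

Lemma mul_revid_mx (F : pzRingType) m p (A : 'M[F]_(m, p)) i j :
  (revid_mx F m *m A) i j = A (rev_ord i) j.
Proof.
rewrite mxE (bigD1 (rev_ord i)) //= mxE eqxx mul1r big1 ?addr0 // => k ki.
by rewrite mxE (negPf ki) mul0r.
Qed.

Lemma revid_mxT (F : pzRingType) m : (revid_mx F m)^T = revid_mx F m.
Proof.
by apply/matrixP => i j; rewrite !mxE -(inj_eq rev_ord_inj) rev_ordK eq_sym.
Qed.

Lemma mulmx_revid (F : pzRingType) m p (A : 'M[F]_(p, m)) i j :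
  (A *m revid_mx F m) i j = A i (rev_ord j).
Proof.
rewrite mxE (bigD1 (rev_ord j)) //= mxE rev_ordK eqxx mulr1 big1 ?addr0 // => k kj.
rewrite mxE (_ : j == _ = false) ?mulr0 //; apply: contraNF kj => /eqP ->.
by rewrite rev_ordK.
Qed.

Lemma revid_mxK (F : pzRingType) m : revid_mx F m *m revid_mx F m = 1%:M.
Proof. by apply/matrixP => i j; rewrite mul_revid_mx !mxE rev_ordK eq_sym. Qed.

Lemma revid_mx_block (F : pzRingType) m k :
  revid_mx F (m + (k + m)) =
  block_mx 0 (row_mx 0 (revid_mx F m))
    (col_mx 0 (revid_mx F m)) (block_mx (revid_mx F k) 0 0 0).
Proof.
apply/matrixP => i j; rewrite !mxE.
case: splitP => i1 ei; rewrite !mxE; case: splitP => j1 ej; rewrite !mxE.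
- rewrite -val_eqE /= ei ej.
  by rewrite (_ : (_ == _) = false) //; apply/eqP; have := ltn_ord i1; have := ltn_ord j1; lia.
- case: splitP => j2 ej2; rewrite !mxE -val_eqE /= ei ej ej2.
    by rewrite (_ : (_ == _) = false) //; apply/eqP; have := ltn_ord i1; have := ltn_ord j2; lia.
  by congr (_%:R); congr nat_of_bool; rewrite -val_eqE /=; apply/eqP/eqP; have := ltn_ord i1; have := ltn_ord j2; lia.
- case: splitP => i2 ei2; rewrite !mxE -val_eqE /= ei ej ei2.
    by rewrite (_ : (_ == _) = false) //; apply/eqP; have := ltn_ord i2; have := ltn_ord j1; lia.
  by congr (_%:R); congr nat_of_bool; rewrite -val_eqE /=; apply/eqP/eqP; have := ltn_ord i2; have := ltn_ord j1; lia.
- case: splitP => i2 ei2; rewrite !mxE; case: splitP => j2 ej2; rewrite !mxE -val_eqE /= ei ej ei2 ej2;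
  have := ltn_ord i2; have := ltn_ord j2 => h1 h2.
  + by congr (_%:R); congr nat_of_bool; rewrite -val_eqE /=; apply/eqP/eqP; lia.
  + by rewrite (_ : (_ == _) = false) //; apply/eqP; lia.
  + by rewrite (_ : (_ == _) = false) //; apply/eqP; lia.
  + by rewrite (_ : (_ == _) = false) //; apply/eqP; lia.
Qed.

(** * Folding along the splitting into skew and symmetric vectors *)

Section Jfold.
Variables (R : rcfType) (m k : nat).
Local Notation J := (revid_mx R _).
Local Notation c := ((Num.sqrt 2)^-1 : R).

(** The columns are the skew vectors [(x, 0, -Jx) / sqrt 2], the middle coordinates, and the
    symmetric vectors [(x, 0, Jx) / sqrt 2]. The middle is left unsplit: reversal acts on it by its
    own [J]. *)
Definition jfold_basis : 'M[R]_(m + (k + m)) :=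
  block_mx c%:M (row_mx 0 c%:M) (col_mx 0 (- c *: J)) (block_mx 1%:M 0 0 (c *: J)).
Local Notation T := jfold_basis.

Definition jfold (Y : 'M[R]_m) (E : 'M[R]_(k + m)) : 'M[R]_(m + (k + m)) :=
  T *m block_mx Y 0 0 E *m T^T.

Lemma inv_sqrt2_sqr : c * c = 2^-1.
Proof. by rewrite -invfM -expr2 sqr_sqrtr ?ler0n. Qed.

Lemma jfold_basisTr :
  T^T = block_mx c%:M (row_mx 0 (- c *: J)) (col_mx 0 c%:M) (block_mx 1%:M 0 0 (c *: J)).
Proof.
by rewrite /T !(tr_block_mx, tr_row_mx, tr_col_mx, tr_scalar_mx, trmx0, linearZ) /= !revid_mxT.
Qed.

Lemma jfold_basis_orth : T^T *m T = 1%:M.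
Proof.
rewrite jfold_basisTr /T !mulmx_block mul_col_row mul_row_col mul_row_block mul_block_col mul_mx_row mul_col_mx.
rewrite !(mul0mx, mulmx0, mul_scalar_mx, mul_mx_scalar, add0r, addr0).
rewrite -!scalemxAl -!scalemxAr !revid_mxK !scalerA.
rewrite !scale_scalar_mx scaler0 add_block_mx !add_row_mx !add_col_mx.
have half : 2^-1 + 2^-1 = 1 :> R by lra.
rewrite !addr0 !add0r !mulr1 mulrNN mulrN mulNr inv_sqrt2_sqr -!(raddfD (@scalar_mx R m)) /= addrN half.
by rewrite (raddf0 (@scalar_mx R m)) row_mx0 col_mx0 -!scalar_mx_block.
Qed.

Lemma jfold_basis_orthr : T *m T^T = 1%:M.
Proof. exact/mulmx1C/jfold_basis_orth. Qed.


Lemma jfold_mul Y E Y' E' : jfold Y E *m jfold Y' E' = jfold (Y *m Y') (E *m E').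
Proof.
rewrite /jfold !mulmxA -[_ *m T^T *m T]mulmxA jfold_basis_orth mulmx1.
by rewrite -[T *m _ *m _]mulmxA mulmx_block !(mul0mx, mulmx0, add0r, addr0).
Qed.

Lemma jfold_tr Y E : (jfold Y E)^T = jfold Y^T E^T.
Proof. by rewrite /jfold !trmx_mul trmxK tr_block_mx !trmx0 mulmxA. Qed.

Lemma jfold_normal Y E : Y *m Y^T = Y^T *m Y -> E *m E^T = E^T *m E ->
  jfold Y E *m (jfold Y E)^T = (jfold Y E)^T *m jfold Y E.
Proof. by move=> nY nE; rewrite jfold_tr !jfold_mul nY nE. Qed.

Lemma jfold_char_poly Y E : char_poly (jfold Y E) = char_poly Y * char_poly E.
Proof.
have TT : map_mx polyC T *m map_mx polyC T^T = 1%:M.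
  by rewrite -map_mxM jfold_basis_orthr map_mx1.
rewrite /char_poly (_ : char_poly_mx (jfold Y E) = map_mx polyC T *m
   char_poly_mx (block_mx Y 0 0 E) *m map_mx polyC T^T).
  rewrite !det_mulmx mulrC mulrA -det_mulmx (mulmx1C TT) det1 mul1r.
  by rewrite char_block_diag_mx det_ublock.
rewrite /char_poly_mx mulmxBr mulmxBl !map_mxM; congr (_ - _).
by rewrite mul_mx_scalar -scalemxAl TT scalemx1.
Qed.

(** Each family of columns is stable under reversal: skew columns change sign, middle ones are
    permuted, symmetric ones are fixed. *)
Lemma revid_jfold_basis :
  revid_mx R (m + (k + m)) *m T = T *m block_mx (- 1%:M) 0 0 (block_mx J 0 0 1%:M).
Proof.
rewrite revid_mx_block /T !mulmx_block.
rewrite !(mul0mx, mulmx0, mulmx1, mul1mx, mul_scalar_mx, mul_mx_scalar, mulmxN, mulNmx, add0r, addr0).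
rewrite mul_col_row mul_row_col !mul_row_block mul_block_col.
rewrite !(mul0mx, mulmx0, mulmx1, mul1mx, mul_scalar_mx, mul_mx_scalar, mulmxN, mulNmx, add0r, addr0).
rewrite -!scalemxAr !revid_mxK.
rewrite scale_col_mx opp_col_mx scaler0 add_col_mx add_block_mx !oppr0 !addr0 !add0r.
by rewrite !scaleNr opprK scalerN scalemx1.
Qed.

(** Half sums and half differences of [X] and [Y] fill the four corners up to reversal, so
    nonnegativity there amounts to [|Y|] being dominated by [X]. *)
Lemma jfold_block Y C G H X : jfold Y (block_mx C G H X) =
  block_mx (2^-1 *: (X + Y)) (row_mx (c *: H) (2^-1 *: (X - Y) *m J))
   (col_mx (c *: G) (J *m (2^-1 *: (X - Y))))
   (block_mx C (c *: G *m J) (c *: J *m H) (2^-1 *: (J *m (X + Y) *m J))).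
Proof.
rewrite /jfold jfold_basisTr /T mulmx_block.
rewrite !(mul0mx, mulmx0, mul_scalar_mx, mul_mx_scalar, add0r, addr0).
rewrite mul_row_block [col_mx 0 _ *m Y]mul_col_mx mulmx_block.
rewrite !(mul0mx, mulmx0, mul1mx, mul_scalar_mx, mul_mx_scalar, add0r, addr0).
rewrite mulmx_block mul_col_row mul_row_col mul_row_block mul_block_col mulmx_block.
rewrite !(mul0mx, mulmx0, mulmx1, mul1mx, mul_scalar_mx, mul_mx_scalar, mulmxN, mulNmx, add0r, addr0).
rewrite -!(scalemxAl, scalemxAr) !scalerA !(scaleNr, scalerN, mulNr, mulrN, opprK) !inv_sqrt2_sqr.
rewrite mul_mx_row mulmx0 mulmxN -scalemxAr scale_row_mx scale_col_mx.
rewrite !(scaler0, scalerN) !scalerA !inv_sqrt2_sqr add_row_mx add_col_mx add_block_mx !add0r.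
by rewrite mulmxBl mulmxBr mulmxDr mulmxDl !scalerDr !scalerN;
   congr (block_mx _ (row_mx _ _) (col_mx _ _) (block_mx _ _ _ _)); rewrite addrC.
Qed.

(** The predicate is abstract so that one case analysis serves nonnegativity, lower bounds and
    bounds on absolute values. *)
Lemma jfold_entry (P : R -> Prop) (Y : 'M[R]_m) (C : 'M_k) (G : 'M_(k, m)) (H : 'M_(m, k)) (X : 'M_m) :
  (forall i j, P (2^-1 * (X i j + Y i j))) -> (forall i j, P (2^-1 * (X i j - Y i j))) ->
  (forall i j, P (C i j)) -> (forall i j, P (c * G i j)) -> (forall i j, P (c * H i j)) ->
  forall i j, P (jfold Y (block_mx C G H X) i j).
Proof.
move=> Pp Pm PC PG PH i j; rewrite jfold_block.
case: (split_ordP i) => i1 ->; case: (split_ordP j) => j1 ->;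
  rewrite ?(block_mxEul, block_mxEur, block_mxEdl, block_mxEdr).
- by rewrite !mxE.
- case: (split_ordP j1) => j2 ->; rewrite ?(row_mxEl, row_mxEr); first by rewrite mxE.
  by rewrite mulmx_revid !mxE.
- case: (split_ordP i1) => i2 ->; rewrite ?(col_mxEu, col_mxEd); first by rewrite mxE.
  by rewrite mul_revid_mx !mxE.
case: (split_ordP i1) => i2 ->; case: (split_ordP j1) => j2 ->;
  rewrite ?(block_mxEul, block_mxEur, block_mxEdl, block_mxEdr) //.
- by rewrite mulmx_revid mxE.
- by rewrite -scalemxAl mxE mul_revid_mx.
- by rewrite mxE mulmx_revid mul_revid_mx mxE.
Qed.

(** Reversal acts on the skew block as [-1]; the two signs cancel under conjugation, so the
    condition bears on [E] alone. *)
Lemma jfold_centrosymmetric Y E :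
  block_mx J 0 0 1%:M *m E *m block_mx J 0 0 1%:M = E -> centrosymmetric (jfold Y E).
Proof.
set K2 := block_mx J 0 0 1%:M => JEJ.
pose K := block_mx (- 1%:M : 'M[R]_m) 0 0 K2.
have KDK : K *m block_mx Y 0 0 E *m K^T = block_mx Y 0 0 E.
  rewrite /K tr_block_mx !mulmx_block linearN /= trmx1 !trmx0.
  rewrite (_ : K2^T = K2); last by rewrite /K2 tr_block_mx !trmx0 trmx1 revid_mxT.
  by rewrite !(mul0mx, mulmx0, mulmx1, mul1mx, add0r, addr0, mulmxN, mulNmx, opprK, oppr0) JEJ.
have TJ : T^T *m revid_mx R _ = K^T *m T^T.
  by rewrite -[revid_mx R _]revid_mxT -!trmx_mul revid_jfold_basis.
rewrite /centrosymmetric /jfold !mulmxA revid_jfold_basis -/K2 -/K.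
by rewrite -[_ *m T^T *m _]mulmxA TJ -[in RHS]KDK !mulmxA.
Qed.

(** With zero skew coordinates, an eigenvector of [E] lifts to one of the fold; this carries Perron
    vectors along. *)
Definition jfold_vec (e : 'cV[R]_(k + m)) : 'cV[R]_(m + (k + m)) := T *m col_mx 0 e.

Lemma jfold_vecE e1 e2 : jfold_vec (col_mx e1 e2) = col_mx (c *: e2) (col_mx e1 (c *: J *m e2)).
Proof.
rewrite /jfold_vec /T mul_block_col mul_row_col mul_block_col.
by rewrite !(mul0mx, mulmx0, mul1mx, mul_scalar_mx, add0r, addr0).
Qed.

Lemma jfold_vec_eigen Y E e a : E *m e = a *: e ->
  jfold Y E *m jfold_vec e = a *: jfold_vec e.
Proof.
move=> Ee; rewrite /jfold /jfold_vec !mulmxA -[_ *m T^T *m T]mulmxA jfold_basis_orth mulmx1.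
rewrite -mulmxA mul_block_col !(mul0mx, mulmx0, add0r, addr0) Ee.
by rewrite scalemxAr scale_col_mx scaler0.
Qed.

Lemma jfold_vec_norm e : (jfold_vec e)^T *m jfold_vec e = e^T *m e.
Proof.
rewrite /jfold_vec trmx_mul !mulmxA -[_ *m T^T *m T]mulmxA jfold_basis_orth mulmx1.
by rewrite tr_col_mx mul_row_col mulmx0 add0r.
Qed.

Lemma jfold_vec_sym e : block_mx J 0 0 1%:M *m e = e ->
  revid_mx R (m + (k + m)) *m jfold_vec e = jfold_vec e.
Proof.
move=> Je; rewrite /jfold_vec mulmxA revid_jfold_basis -mulmxA mul_block_col.
by rewrite !(mul0mx, mulmx0, add0r, addr0) Je.
Qed.
End Jfold.

(** * Characteristic polynomials of bordered matrices *)

Lemma char_poly_mx_block (F : comNzRingType) n1 n2 (A : 'M[F]_n1) B C (D : 'M[F]_n2) :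
  char_poly_mx (block_mx A B C D) =
  block_mx (char_poly_mx A) (- map_mx polyC B) (- map_mx polyC C) (char_poly_mx D).
Proof.
by rewrite /char_poly_mx scalar_mx_block map_block_mx opp_block_mx add_block_mx !add0r.
Qed.

Lemma char_poly_mx_eigen (F : comNzRingType) n (A : 'M[F]_n) (v : 'cV_n) a : A *m v = a *: v ->
  char_poly_mx A *m map_mx polyC v = ('X - a%:P) *: map_mx polyC v.
Proof.
by move=> Av; rewrite /char_poly_mx mulmxBl mul_scalar_mx -map_mxM Av map_mxZ scalerBl.
Qed.

Lemma char_poly_scalar1 (F : comNzRingType) (t : F) : char_poly (t%:M : 'M_1) = 'X - t%:P.
Proof. by rewrite /char_poly det_mx11 !mxE !mulr1n. Qed.

Section BorderedCharPoly.
Variables (F : comNzRingType) (n : nat) (A : 'M[F]_n) (v : 'cV[F]_n) (a q r t : F).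
Hypotheses (Av : A *m v = a *: v) (vv : v^T *m v = q%:M).

Let vvP : map_mx polyC v^T *m map_mx polyC v = (q%:P)%:M.
Proof. by rewrite -map_mxM vv map_scalar_mx. Qed.

Let poly_tm : char_poly_mx (t%:M : 'M_1) = ('X - t%:P)%:M.
Proof. by rewrite /char_poly_mx map_scalar_mx /= -raddfB. Qed.

(** Bordering along an eigenvector trades the root [a] for the two roots of the 2x2 matrix with rows
    [(a, r q)] and [(r, t)]. The factor ['X - a%:P] on the left avoids a division. *)
Lemma char_poly_border_dr :
  char_poly (block_mx A (r *: v) (r *: v^T) t%:M) * ('X - a%:P) =
  char_poly A * (('X - a%:P) * ('X - t%:P) - (r ^+ 2 * q)%:P).
Proof.
rewrite /char_poly char_poly_mx_block poly_tm !map_mxZ.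
set V := map_mx polyC v; set a' := 'X - a%:P; set t' := 'X - t%:P.
(* The right factor is a column operation of determinant ['X - a%:P]; it clears the upper right
   block because [v] is an eigenvector. *)
transitivity (\det (block_mx (char_poly_mx A) (- (r%:P *: V)) (- (r%:P *: map_mx polyC v^T)) (t'%:M) *m
   block_mx 1%:M (r%:P *: V) 0 a'%:M)).
  by rewrite det_mulmx det_ublock det1 mul1r det_scalar1.
rewrite mulmx_block !(mulmx1, mulmx0, addr0) -scalemxAr (char_poly_mx_eigen Av) -/V -/a'.
rewrite mulNmx mul_mx_scalar scalerA mulrC -scalerA subrr.
rewrite det_lblock; congr (_ * _).
rewrite mulNmx -scalemxAl -scalemxAr vvP -scalar_mxM !scale_scalar_mx.
rewrite -raddfN -raddfD /= det_scalar1 polyCM expr2 polyCM.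
ring.
Qed.

Lemma char_poly_border_ul :
  char_poly (block_mx t%:M (r *: v^T) (r *: v) A) * ('X - a%:P) =
  char_poly A * (('X - a%:P) * ('X - t%:P) - (r ^+ 2 * q)%:P).
Proof.
rewrite /char_poly char_poly_mx_block poly_tm !map_mxZ.
set V := map_mx polyC v; set a' := 'X - a%:P; set t' := 'X - t%:P.
transitivity (\det (block_mx t'%:M (- (r%:P *: map_mx polyC v^T)) (- (r%:P *: V)) (char_poly_mx A) *m
   block_mx a'%:M 0 (r%:P *: V) 1%:M)).
  by rewrite det_mulmx det_lblock det1 mulr1 det_scalar1.
rewrite mulmx_block !(mulmx1, mulmx0, addr0, add0r) -[char_poly_mx A *m _]scalemxAr (char_poly_mx_eigen Av) -/V -/a'.
rewrite [- (_ *: V) *m _]mulNmx !mul_mx_scalar !scalerA [r%:P * _]mulrC addNr.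
rewrite det_ublock mulrC; congr (_ * _).
rewrite mulNmx -scalemxAl -scalemxAr vvP !scale_scalar_mx.
rewrite -raddfN -raddfD /= det_scalar1 polyCM expr2 polyCM.
ring.
Qed.
End BorderedCharPoly.

(** * Perron data and their behaviour under folding *)

(** Sharing the eigenvector between [X] and [X^T] is what keeps a matrix bordered by rank-one blocks
    normal. The squared length [q] is left unnormalised. *)
Definition perron (R : rcfType) n (X : 'M[R]_n) (a : R) (v : 'cV[R]_n) (q : R) : Prop :=
  [/\ X *m X^T = X^T *m X, nonneg_mx X, X *m v = a *: v, X^T *m v = a *: v &
      [/\ forall i j, 0 <= v i j, v^T *m v = q%:M & 0 < q]].

(** The two linear equations say that [(x, y)] is an eigenvector for [a] of the 2x2 compression of
    the symmetric part to the span of [w] and [u]; its scalar [g] is the eigenvalue of [C] at [w]. *)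
Lemma perron_jfold (R : rcfType) k m (C : 'M[R]_k) (w : 'cV_k) (X Y : 'M[R]_m) (u : 'cV_m)
    (b a g p q r x y : R) :
  C *m C^T = C^T *m C -> nonneg_mx C -> centrosymmetric C ->
  C *m w = g *: w -> C^T *m w = g *: w -> (forall i j, 0 <= w i j) ->
  revid_mx R k *m w = w -> w^T *m w = q%:M ->
  perron X b u p -> Y *m Y^T = Y^T *m Y -> (forall i j, `|Y i j| <= X i j) ->
  0 <= r -> 0 <= x -> 0 <= y -> g * x + r * y * p = a * x -> r * x * q + b * y = a * y ->
  0 < x ^+ 2 * q + y ^+ 2 * p ->
  let E := block_mx C (r *: (w *m u^T)) (r *: (u *m w^T)) X in
  [/\ exists v s, perron (jfold Y E) a v s /\ revid_mx R _ *m v = v,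
      centrosymmetric (jfold Y E) &
      char_poly (jfold Y E) = char_poly Y * char_poly E].
Proof.
move=> nC C0 JC Cw Ctw w0 Jw ww [nX X0 Xu Xtu [u0 uu _]] nY YX r0 x0 y0 e1 e2 s0 E.
have Et : E^T = block_mx C^T (r *: (w *m u^T)) (r *: (u *m w^T)) X^T.
  by rewrite /E tr_block_mx !linearZ /= !trmx_mul !trmxK.
have wC : w^T *m C = g *: w^T by rewrite -[LHS]trmxK trmx_mul trmxK Ctw linearZ.
have wCt : w^T *m C^T = g *: w^T by rewrite -trmx_mul Cw linearZ.
have uX : u^T *m X = b *: u^T by rewrite -[LHS]trmxK trmx_mul trmxK Xtu linearZ.
have uXt : u^T *m X^T = b *: u^T by rewrite -trmx_mul Xu linearZ.
(* In both products the off-diagonal blocks are [r * (g + b)] times [w *m u^T] and [u *m w^T]. *)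
have nE : E *m E^T = E^T *m E.
  rewrite Et /E !mulmx_block -!(scalemxAl, scalemxAr) !mulmxA Cw Ctw Xu Xtu nC nX.
  by rewrite -!mulmxA wC wCt uX uXt -!(scalemxAl, scalemxAr).
(* Stated for general [D] and [Z] so as to apply to both [E] and [E^T]. *)
have eigE D Z : D *m w = g *: w -> Z *m u = b *: u ->
    block_mx D (r *: (w *m u^T)) (r *: (u *m w^T)) Z *m col_mx (x *: w) (y *: u)
    = a *: col_mx (x *: w) (y *: u).
  move=> Dw Zu; rewrite mul_block_col -!(scalemxAl, scalemxAr) -!mulmxA uu ww Dw Zu.
  rewrite !mul_mx_scalar !scalerA -!scalerDl scale_col_mx !scalerA -e1 -e2.
  by congr (col_mx (_ *: _) (_ *: _)); ring.
have c0 : 0 <= (Num.sqrt 2)^-1 :> R by rewrite invr_ge0 sqrtr_ge0.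
split.
- exists (jfold_vec (col_mx (x *: w) (y *: u))), (x ^+ 2 * q + y ^+ 2 * p); split; last first.
    apply: jfold_vec_sym.
    by rewrite mul_block_col !mul0mx addr0 add0r mul1mx -scalemxAr Jw.
  split.
  + exact: jfold_normal.
  + refine (jfold_entry (P := fun z => 0 <= z) _ _ _ _ _) => [i j|i j|//|i j|i j].
    * by have := YX i j; rewrite ler_norml; lra.
    * by have := YX i j; rewrite ler_norml; lra.
    * by rewrite !mxE big_ord1 !mxE !mulr_ge0.
    * by rewrite !mxE big_ord1 !mxE !mulr_ge0.
  + exact/jfold_vec_eigen/eigE.
  + by rewrite jfold_tr Et; apply/jfold_vec_eigen/eigE.
  + split => //.
      move=> i j; rewrite jfold_vecE mxE; case: splitP => i1 _; first by rewrite !mxE !mulr_ge0.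
      rewrite mxE; case: splitP => i2 _; first by rewrite !mxE !mulr_ge0.
      by rewrite -scalemxAl mxE mul_revid_mx !mxE !mulr_ge0.
    rewrite jfold_vec_norm tr_col_mx mul_row_col !linearZ /= -!(scalemxAl, scalemxAr) uu ww.
    by rewrite !scale_scalar_mx -raddfD /= !expr2 !mulrA.
- apply: jfold_centrosymmetric; rewrite /E !mulmx_block.
  rewrite !(mul0mx, mulmx0, mulmx1, mul1mx, addr0, add0r) JC -!(scalemxAl, scalemxAr).
  rewrite mulmxA Jw -mulmxA (_ : w^T *m _ = w^T) //.
  by rewrite -[LHS]trmxK trmx_mul trmxK revid_mxT Jw.
- exact: jfold_char_poly.
Qed.

(** With an empty middle block the coefficients [x = 0], [y = 1] lift [u] itself, and the Perron
    root is unchanged. *)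
Lemma perron_jfold0 (R : rcfType) m (X Y : 'M[R]_m) (u : 'cV_m) (b p : R) :
  perron X b u p -> Y *m Y^T = Y^T *m Y -> (forall i j, `|Y i j| <= X i j) ->
  let Q := jfold (k := 0) Y (block_mx 0 0 0 X) in
  [/\ exists v s, perron Q b v s /\ revid_mx R _ *m v = v,
      centrosymmetric Q &
      char_poly Q = char_poly Y * char_poly X].
Proof.
move=> PX nY YX Q.
have [_ _ _ _ [_ _ p0]] := PX.
have := @perron_jfold R 0 m 0 0 X Y u b b 0 p 0 0 0 1.
rewrite !(mul0mx, mulmx0, trmx0, scaler0, scale0r) -/Q.
have -> : char_poly Q = char_poly Y * char_poly X.
  by rewrite /Q jfold_char_poly {2}/char_poly char_block_diag_mx det_ublock det_mx00 mul1r.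
case=> //.
- by case.
- by rewrite /centrosymmetric mulmx0 mul0mx.
- by case.
- by rewrite raddf0.
- by rewrite !mul0r mulr0 add0r.
- by rewrite !mul0r !mulr1 add0r.
- by rewrite mulr0 add0r expr1n mul1r.
Qed.

(** * Real 2x2 blocks for conjugate pairs *)

Definition rot2 (R : rcfType) (z : R[i]) : 'M[R]_2 :=
  \matrix_(i < 2, j < 2) if i == j then complex.Re z else
                         if (i < j)%N then complex.Im z else - complex.Im z.

Definition conj_pair_poly (R : rcfType) (z : R[i]) : {poly R} :=
  ('X - (complex.Re z)%:P) ^+ 2 + (complex.Im z ^+ 2)%:P.

Lemma ord2P (i : 'I_2) : {i = 0} + {i = 1}.
Proof. by case: i => [[|[|//]] Hi]; [left | right]; apply: val_inj. Qed.

Lemma rot2_normal (R : rcfType) (z : R[i]) : rot2 z *m (rot2 z)^T = (rot2 z)^T *m rot2 z.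
Proof.
apply/matrixP => i j; rewrite !mxE !big_ord_recr !big_ord0 /=.
by case: (ord2P i) => ->; case: (ord2P j) => ->; rewrite !mxE /=; ring.
Qed.

Lemma rot2_char_poly (R : rcfType) (z : R[i]) : char_poly (rot2 z) = conj_pair_poly z.
Proof.
rewrite /char_poly (expand_det_row _ 0) !big_ord_recr big_ord0 /= /cofactor !det_mx11 !mxE /=.
rewrite /conj_pair_poly rmorphXn rmorphN /=; ring.
Qed.

Lemma rot2_le (R : rcfType) (z : R[i]) i j : `|rot2 z i j| <= Normc.normc z.
Proof.
have le (x y : R) : `|x| <= Num.sqrt (x ^+ 2 + y ^+ 2).
  by rewrite -sqrtr_sqr ler_wsqrtr // lerDl sqr_ge0.
by case: z => x y; case: (ord2P i) => ->; case: (ord2P j) => ->;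
   rewrite !mxE /= ?normrN // addrC.
Qed.

Lemma map_conj_pair_poly (R : rcfType) (z : R[i]) :
  map_poly (fun x : R => (x%:C)%C) (conj_pair_poly z) = ('X - z%:P) * ('X - (conjc z)%:P).
Proof.
have -> : map_poly (fun x : R => (x%:C)%C) (conj_pair_poly z) =
  ('X - ((complex.Re z)%:C)%C%:P) ^+ 2 + (((complex.Im z)%:C)%C ^+ 2)%:P.
  by rewrite /conj_pair_poly rmorphD rmorphXn rmorphB /= map_polyX !map_polyC /= rmorphXn.
case: z => x y /=.
(* Taking [w = i y] turns the claim into a difference of squares, which [ring] can check. *)
have [w -> [-> ->]] : exists2 w : R[i], (y%:C ^+ 2 = - w ^+ 2)%C &
    (x +i* y = x%:C + w)%C /\ (x -i* y = x%:C - w)%C.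
  exists (0 +i* y)%C; first by apply/eqP; rewrite !expr2 eq_complex /=; apply/andP; split; apply/eqP; ring.
  by split; apply/eqP; rewrite eq_complex /=; apply/andP; split; apply/eqP; ring.
by rewrite !(rmorphD, rmorphN, rmorphXn) /=; ring.
Qed.

Lemma perron_scalar1 (R : rcfType) (t : R) : 0 <= t -> perron (t%:M : 'M_1) t 1%:M 1.
Proof.
move=> t0; split; rewrite ?tr_scalar_mx ?mulmx1 ?scalemx1 //.
  by move=> i j; rewrite !ord1 mxE.
by split; rewrite ?trmx1 ?mulmx1 // => i j; rewrite !ord1 mxE.
Qed.

Lemma core4 (R : rcfType) (rho lam1 : R) (z1 z2 z3 : R[i]) :
  lam1 < 0 -> 2 * (Normc.normc z1 + Normc.normc z2 + Normc.normc z3) <= rho + lam1 ->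
  exists X Y : 'M[R]_4,
    [/\ exists u p, perron X rho u p, Y *m Y^T = Y^T *m Y, forall i j, `|Y i j| <= X i j,
        char_poly X = conj_pair_poly z1 * (('X - lam1%:P) * ('X - rho%:P)) &
        char_poly Y = conj_pair_poly z2 * conj_pair_poly z3].
Proof.
move=> l1 bnd.
have z0 (z : R[i]) : 0 <= Normc.normc z by case: z => x y; apply: sqrtr_ge0.
have := (z0 z1, z0 z2, z0 z3); move=> [[z10 z20] z30].
have r0 : 0 <= rho by lra.
have Y0 (M M' : 'M[R]_1) : M *m M' = M' *m M.
  by apply/matrixP => i j; rewrite !ord1 !mxE !big_ord1 mulrC.
have [||] := @perron_jfold0 R 1 rho%:M lam1%:M 1%:M rho 1 (perron_scalar1 r0).
- exact: Y0.
- by move=> i j; rewrite !ord1 !mxE /= !mulr1n ler_norml; lra.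
set S := jfold _ _ => - [u [p [PS _]]] _; rewrite !char_poly_scalar1 => chS.
(* The entries of [S] are [(rho + lam1) / 2] and [(rho - lam1) / 2]; the first is the smaller since
   [lam1 < 0], and by [bnd] it is at least the sum of the three moduli. *)
have leS i j : (rho + lam1) / 2 <= S i j.
  apply: (@jfold_entry R 1 0 (fun x => (rho + lam1) / 2 <= x)) => [{}i {}j|{}i {}j|[] //|[] //|i' []//].
    by rewrite !ord1 !mxE /= !mulr1n; lra.
  by rewrite !ord1 !mxE /= !mulr1n; lra.
have [|] := @perron_jfold0 R 2 S (rot2 z1) u rho p PS (rot2_normal z1).
  by move=> i j; apply: le_trans (rot2_le _ _ _) (le_trans _ (leS _ _)); lra.
set X := jfold _ _ => - [u' [p' [PX _]]] _; rewrite rot2_char_poly => chX.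
exists X, (jfold (k := 0) (rot2 z2) (block_mx 0 0 0 (rot2 z3))); split.
- by exists u', p'.
- apply: (@jfold_normal R 2 0); first exact: rot2_normal.
  by rewrite tr_block_mx !trmx0 !mulmx_block !(mul0mx, mulmx0, add0r) rot2_normal.
(* An entry of [X] is half of an entry of [S] plus or minus one of [rot2 z1]: the modulus of [z1] is
   used up, and half of the other two remains. *)
- have leX i j : (Normc.normc z2 + Normc.normc z3) / 2 <= X i j.
    apply: (@jfold_entry R 2 0 (fun x => _ <= x)) => [{}i {}j|{}i {}j|[] //|[] //|i' []//].
      by have := rot2_le z1 i j; have := leS i j; rewrite ler_norml; lra.
    by have := rot2_le z1 i j; have := leS i j; rewrite ler_norml; lra.
  move=> i j; apply: le_trans (leX i j).
  apply: (@jfold_entry R 2 0 (fun x => `|x| <= _)) => [{}i {}j|{}i {}j|[] //|[] //|i' []//].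
    by have := rot2_le z2 i j; have := rot2_le z3 i j; rewrite !ler_norml; lra.
  by have := rot2_le z2 i j; have := rot2_le z3 i j; rewrite !ler_norml; lra.
- by rewrite chX chS.
apply: (etrans (@jfold_char_poly R 2 0 _ _)); rewrite rot2_char_poly.
rewrite {1}/char_poly char_block_diag_mx det_ublock.
by rewrite det_mx00 mul1r -/(char_poly _) rot2_char_poly.
Qed.

(** * Realizable spectra: inductive step and base cases *)

(** The reversal-invariant Perron vector is kept because the next gluing borders along it. *)
Definition realizable (R : rcfType) N (a : R) (chi : {poly R}) : Prop :=
  exists Q : 'M[R]_N,
    [/\ exists v s, perron Q a v s /\ revid_mx R _ *m v = v, centrosymmetric Q & char_poly Q = chi].

(** With [r ^+ 2 * q = t * g - a * l], the matrix with rows [(g, r q)] and [(r, t)] has trace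
    [a + l] and determinant [a * l], hence roots [a] and [l]. The skew entry [- t] gives the factor
    ['X + t%:P] and meets the domination bound with equality. *)
Lemma realizable_add2 (R : rcfType) N (g a l t : R) (chi : {poly R}) :
  0 <= t -> t <= a -> 0 < a -> l < 0 -> 0 <= g -> g + t = a + l ->
  realizable N g (('X - g%:P) * chi) ->
  realizable (1 + (N + 1)) a (('X - a%:P) * ('X - l%:P) * ('X + t%:P) * chi).
Proof.
move=> t0 ta a0 l0 g0 e [C [[w [q [[nC C0 Cw Ctw [w0 ww q0]] Jw]]] JC chC]].
have al : a * l < 0 by rewrite pmulr_rlt0.
have tg : 0 <= t * g by exact: mulr_ge0.
have rr0 : 0 < (t * g - a * l) / q by rewrite divr_gt0 //; lra.
pose r := Num.sqrt ((t * g - a * l) / q).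
have r0 : 0 < r by rewrite sqrtr_gt0.
have rq : r ^+ 2 * q = t * g - a * l by rewrite sqr_sqrtr ?(ltW rr0) // divfK ?gt_eqF.
(* The vector [(a - t, r * q)] solves the second equation identically and the first by the choice of
   [r]; [t <= a] makes it nonnegative. *)
have := @perron_jfold R N 1 C w t%:M (- t)%:M 1%:M t a g 1 q r (a - t) (r * q).
have le : l = g + t - a by lra.
case=> //.
- exact: perron_scalar1.
- by rewrite tr_scalar_mx.
- by move=> i j; rewrite !ord1 !mxE /= !mulr1n normrN ger0_norm.
- exact: ltW.
- by rewrite subr_ge0.
- by rewrite mulr_ge0 ?ltW.
- by rewrite mulr1 mulrA -expr2 rq le; ring.
- ring.
- rewrite mulr1; apply: ltr_wpDl; first by rewrite mulr_ge0 ?sqr_ge0 ?(ltW q0).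
  by rewrite exprn_gt0 // mulr_gt0.
rewrite trmx1 mulmx1 mul1mx => P JQ chQ; exists (jfold (- t)%:M (block_mx C (r *: w) (r *: w^T) t%:M)).
split=> //; rewrite chQ char_poly_scalar1.
apply: (@mulIf _ ('X - g%:P)); first by rewrite polyXsubC_eq0.
rewrite -[LHS]mulrA (char_poly_border_dr r t Cw ww) chC rq le.
rewrite !(rmorphB, rmorphD, rmorphM, rmorphN) /=; ring.
Qed.

Section BaseCases.
Variables (R : rcfType) (l1 : R) (z1 z2 z3 : R[i]).
Hypothesis l1_lt0 : l1 < 0.
Let nz : R := Normc.normc z1 + Normc.normc z2 + Normc.normc z3.
Let pz : {poly R} := conj_pair_poly z1 * conj_pair_poly z2 * conj_pair_poly z3.

Lemma realizable8 (a : R) : 2 * nz <= a + l1 ->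
  realizable 8 a (('X - a%:P) * ('X - l1%:P) * pz).
Proof.
move=> /(core4 l1_lt0) [X [Y [[u [p PX]] nY YX chX chY]]].
have [P JQ chQ] := perron_jfold0 PX nY YX.
by exists (jfold (k := 0) Y (block_mx 0 0 0 X)); split=> //; rewrite chQ chX chY /pz; ring.
Qed.

(** The core is built for the root [a + l2]; gluing it to [0] with [r ^+ 2 * p = - (a * l2)] keeps
    the trace [a + l2] and makes the determinant [a * l2], so that root splits into [a] and [l2]. *)
Lemma realizable9 (a l2 : R) : l2 < 0 -> 0 < a -> 2 * nz <= a + l2 + l1 ->
  realizable 9 a (('X - a%:P) * (('X - l1%:P) * ('X - l2%:P)) * pz).
Proof.
move=> l20 a0 /(core4 l1_lt0) [X [Y [[u [p PX]] nY YX chX chY]]].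
have [_ _ Xu _ [_ uu p0]] := PX.
have rr0 : 0 <= - (a * l2) / p by rewrite divr_ge0 ?oppr_ge0 ?pmulr_rle0 // ltW.
pose r := Num.sqrt (- (a * l2) / p).
have r0 : 0 <= r by exact: sqrtr_ge0.
have rp : r ^+ 2 * p = - (a * l2) by rewrite sqr_sqrtr // divfK ?gt_eqF.
have := @perron_jfold R 1 4 0 1%:M X Y u (a + l2) a 0 p 1 r (r * p) a.
case=> //.
- by rewrite trmx0.
- by move=> i j; rewrite mxE.
- by rewrite /centrosymmetric mulmx0 mul0mx.
- by rewrite mul0mx scale0r.
- by rewrite trmx0 mul0mx scale0r.
- by move=> i j; rewrite !ord1 mxE.
- by apply/matrixP => i j; rewrite mulmx1 !ord1 !mxE.
- by rewrite trmx1 mulmx1.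
- by apply: mulr_ge0 => //; apply: ltW.
- exact: ltW.
- ring.
- by rewrite mulr1 mulrA -expr2 rp; ring.
- by rewrite mulr1; apply: ltr_wpDl; rewrite ?sqr_ge0 // mulr_gt0 // exprn_gt0.
rewrite trmx1 mulmx1 mul1mx => P JQ chQ; exists (jfold (k := 1) Y (block_mx 0 (r *: u^T) (r *: u) X)).
have z0 : 0 = 0%:M :> 'M[R]_1 by rewrite raddf0.
split=> //; rewrite chQ chY.
apply: (@mulIf _ ('X - (a + l2)%:P)); first by rewrite polyXsubC_eq0.
rewrite -[LHS]mulrA z0 (char_poly_border_ul r 0 Xu uu) chX rp.
rewrite /pz !(rmorphB, rmorphD, rmorphM, rmorphN, rmorph0) /=; ring.
Qed.
End BaseCases.

Lemma sum_neg_le0 (R : rcfType) (lam : nat -> R) n :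
  (forall j, (1 <= j <= n)%N -> lam j < 0) -> \sum_(1 <= j < n.+1) lam j <= 0.
Proof.
by move=> h; rewrite big_nat; apply: sumr_le0 => j /h /ltW.
Qed.

Lemma realizable_spectrum (R : rcfType) (z1 z2 z3 : R[i]) n (lam : nat -> R) :
  let nz := Normc.normc z1 + Normc.normc z2 + Normc.normc z3 in
  0 < nz -> (0 < n)%N -> (forall j, (1 <= j <= n)%N -> lam j < 0) ->
  2 * nz <= lam 0%N + \sum_(1 <= j < n.+1) lam j ->
  realizable (n + 7) (lam 0%N) (\prod_(0 <= j < n.+1) ('X - (lam j)%:P) *
    (conj_pair_poly z1 * conj_pair_poly z2 * conj_pair_poly z3)).
Proof.
move=> nz nz0.
pose P n := forall lam : nat -> R, (forall j, (1 <= j <= n)%N -> lam j < 0) ->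
  2 * nz <= lam 0%N + \sum_(1 <= j < n.+1) lam j ->
  realizable (n + 7) (lam 0%N) (\prod_(0 <= j < n.+1) ('X - (lam j)%:P) *
    (conj_pair_poly z1 * conj_pair_poly z2 * conj_pair_poly z3)).
(* Each step adds two eigenvalues, so two consecutive cases are carried together. *)
suff PP m : P m.+1 /\ P m.+2 by case: n => // n _; apply: (PP n).1.
elim: m => [|m [IH1 IH2]]; split=> //.
- move=> l ln; rewrite /index_iota /= !big_cons !big_nil addr0 mulr1 => h.
  by apply: realizable8 => //; apply: ln.
- move=> l ln; rewrite /index_iota /= !big_cons !big_nil addr0 mulr1 => h.
  have l1 := ln 1%N isT; have l2 := ln 2 isT.
  by apply: realizable9 => //; rewrite -?/nz; lra.
move=> l ln h.
(* The last two eigenvalues are absorbed into the Perron root, which leaves the total sum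
   unchanged. *)
pose l' j := if j == 0%N then l 0%N + l m.+2 + l m.+3 else l j.
have sl' : \sum_(1 <= j < m.+2) l' j = \sum_(1 <= j < m.+2) l j.
  by apply: eq_big_nat => j /andP[j1 _]; rewrite /l' gtn_eqF.
have ln' j : (1 <= j <= m.+1)%N -> l' j < 0.
  by move=> /andP[j1 j2]; rewrite /l' gtn_eqF //; apply: ln; lia.
(* Since the remaining sum is nonpositive, the new Perron root is at least [2 * nz]; this yields the
   sign conditions and [t <= a] for the gluing. *)
have sle := sum_neg_le0 ln'; rewrite sl' in sle.
have h' : 2 * nz <= l' 0%N + \sum_(1 <= j < m.+2) l' j.
  by rewrite sl' /l' /=; move: h; rewrite big_nat_recr //= big_nat_recr //=; lra.
have l2 : l m.+2 < 0 by apply: ln; lia.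
have l3 : l m.+3 < 0 by apply: ln; lia.
set pz := _ * _ * conj_pair_poly z3.
have {IH1} := IH1 l' ln' h'; rewrite big_nat_recl // -mulrA -/pz => H.
rewrite sl' /l' /= in h'.
have -> : (m.+3 + 7 = 1 + (m.+1 + 7 + 1))%N by lia.
rewrite big_nat_recl // 2?big_nat_recr //=.
(* With [t = - l m.+3] the trace condition is exactly the definition of [l' 0]. *)
have := @realizable_add2 R _ (l' 0%N) (l 0%N) (l m.+2) (- l m.+3) _ _ _ _ _ _ _ H.
rewrite /l' /= => H'.
set p := \prod_(0 <= i < m.+1) _ in H' *.
rewrite (_ : _ * pz = ('X - (l 0%N)%:P) * ('X - (l m.+2)%:P) * ('X + (- l m.+3)%:P) * (p * pz));
  first by apply: H'; lra.
rewrite rmorphN /=; ring.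
Qed.

(** * Passage to the complex spectrum *)

Unset Implicit Arguments.
Set Strict Implicit.

Theorem theorem3p13 (R : realType) (n : nat) (lam : nat -> R) (z1 z2 z3 : R[i]) :
  (1 <= n)%N ->
  0 <= lam 0%N ->
  lam 1%N < 0 ->
  (forall j : nat, (1 <= j < n)%N -> lam j.+1 <= lam j) ->
  0 < complex.Im z1 -> 0 < complex.Im z2 -> 0 < complex.Im z3 ->
  0 <= lam 0%N + \sum_(1 <= j < n.+1) lam j
         - 2 * (Normc.normc z1 + Normc.normc z2 + Normc.normc z3) ->
  exists Q : 'M[R]_(n + 7),
    [/\ normal_mx (cplx_mx Q), centrosymmetric Q, nonneg_mx Q &
        has_eigenvalues Q
          ([seq ((lam j)%:C)%C | j <- iota 0 n.+1]
             ++ [:: z1; z2; z3; conjc z1; conjc z2; conjc z3])].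
Proof.
move=> n1 _ lam1 lamS i1 i2 i3 h.
have norm_gt0 (z : R[i]) : 0 < complex.Im z -> 0 < Normc.normc z.
  by case: z => x y /= y0; rewrite sqrtr_gt0 ltr_wpDl ?sqr_ge0 ?exprn_gt0.
have lam_lt0 j : (1 <= j <= n)%N -> lam j < 0.
  elim: j => // -[//|j] IH /andP[_ jn]; apply: le_lt_trans (IH _); first exact: lamS.
  exact: ltnW.
have [||Q [[v [s [[nQ Q0 _ _ _] _]]] JQ chQ]] := @realizable_spectrum R z1 z2 z3 n lam _ n1 lam_lt0.
- by rewrite !addr_gt0 ?norm_gt0.
- by lra.
exists Q; split=> //.
  (* On a real matrix the conjugate transpose is the transpose, so real normality transfers. *)
  rewrite /normal_mx (_ : ctrmx (cplx_mx Q) = cplx_mx Q^T).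
    by rewrite /cplx_mx -!(map_mxM (real_complex R)) nQ.
  by apply/matrixP => i j; rewrite !mxE conjc_real.
rewrite /has_eigenvalues /cplx_mx -(map_char_poly (real_complex R)) chQ /index_iota subn0.
(* Generalizing the index list stops simplification from unrolling its head. *)
move: (iota 0 n.+1) => s0.
rewrite big_cat big_map /= !big_cons big_nil mulr1.
rewrite !rmorphM /= !map_conj_pair_poly rmorph_prod; congr (_ * _); last by ring.
by apply: eq_bigr => j _; rewrite rmorphB /= map_polyX map_polyC.
Qed.
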